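(* Let $M\in[0,\infty]$, let $I$ be an index set, and let $x_i\in\mathbb{E}$, $g_i\in\mathbb{E}^*$, $f_i\in\mathbb{R}$ for $i\in I$. The set $\{(x_i,g_i,f_i)\}_{i\in I}$ is $\mathcal{I}^*_M$-interpolable (resp. $\mathcal{I}'^*_M$-interpolable), i.e. interpolable by a support function with $M$-bounded subgradients, if and only if the following hold for every pair of indices $i\in I$ and $j\in I$: $$\langle g_i,x_i\rangle-f_i=0,$$ $$\langle g_i-g_j,x_j\rangle\leq 0,$$ $$\|g_i\|_{\mathbb{E}^*}\leq M\qquad(\text{resp. }\|g_i-g_j\|_{\mathbb{E}^*}\leq M).$$
   Context: $\mathbb{E}$ is a finite-dimensional real vector space with dual $\mathbb{E}^*$, $\langle\cdot,\cdot\rangle:\mathbb{E}^*\times\mathbb{E}\to\mathbb{R}$ is a dual pairing (nondegenerate bilinear map), $B:\mathbb{E}\to\mathbb{E}^*$ is a self-adjoint positive definite linear operator, and $\|s\|_{\mathbb{E}^*}^2=\langle s,B^{-1}s\rangle$ for $s\in\mathbb{E}^*$. $\mathcal{I}^*_M(\mathbb{E})$ is the set of support functions $f:\mathbb{E}\to\mathbb{R}\cup\{\infty\}$, $f(x)=\sup_{s\in Q}\langle s,x\rangle$, of nonempty closed convex sets $Q\subseteq\mathbb{E}^*$ with $\|s\|_{\mathbb{E}^*}\leq M$ for all $s\in Q$ (equivalently, the Legendre–Fenchel conjugates of indicator functions of such sets $Q$). $\mathcal{I}'^*_M(\mathbb{E})$ is defined in the same way, but with the condition $\|s_1-s_2\|_{\mathbb{E}^*}\leq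 M$ for all $s_1,s_2\in Q$. ($M=\infty$ means no boundedness requirement.) For a class $\mathcal{F}(\mathbb{E})$ of convex functions, a set $\{(x_i,g_i,f_i)\}_{i\in I}\subset\mathbb{E}\times\mathbb{E}^*\times\mathbb{R}$ is $\mathcal{F}$-interpolable if there exists $F\in\mathcal{F}(\mathbb{E})$ such that $g_i\in\partial F(x_i)$ and $F(x_i)=f_i$ for all $i\in I$, where $\partial F$ is the convex subdifferential (with respect to the pairing $\langle\cdot,\cdot\rangle$). *)

(* Defs.v *)
From HB Require Import structures.
From mathcomp Require Import all_boot all_order all_algebra.
From mathcomp Require Import all_classical all_reals all_analysis.

Set Implicit Arguments.
Unset Strict Implicit.
Unset Printing Implicit Defensive.

Import Order.TTheory GRing.Theory Num.Theory.

Local Open Scope classical_set_scope.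
Local Open Scope ring_scope.

(* The primal space is [E] and its dual is a second finite-dimensional space
   [Es], related to [E] only through the pairing [p s x] = <s, x>. *)

Section DualPair.
Context {R : realType} {E Es : vectType R}.

Definition nondegenerate_pairing (p : {bilinear Es -> E -> R | *%R & *%R}) :
    Prop :=
  (forall s : Es, (forall x : E, p s x = 0) -> s = 0) /\
  (forall x : E, (forall s : Es, p s x = 0) -> x = 0).

Definition self_adjoint (p : {bilinear Es -> E -> R | *%R & *%R})
    (B : 'Hom(E, Es)) : Prop :=
  forall x y : E, p (B x) y = p (B y) x.

Definition positive_definite (p : {bilinear Es -> E -> R | *%R & *%R})
    (B : 'Hom(E, Es)) : Prop :=
  forall x : E, x != 0 -> 0 < p (B x) x.

(* [(B^-1)%VF] is the two-sided inverse of [B] once [p] is nondegenerate and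
   [B] is positive definite, since [B] is then bijective. *)
Definition dual_norm (p : {bilinear Es -> E -> R | *%R & *%R})
    (B : 'Hom(E, Es)) (s : Es) : R :=
  Num.sqrt (p s ((B^-1)%VF s)).

(* A [vectType] carries no topology in the library, so closedness is spelled
   out for the dual norm: [Q] contains all of its limit points. *)
Definition dual_closed (p : {bilinear Es -> E -> R | *%R & *%R})
    (B : 'Hom(E, Es)) (Q : set Es) : Prop :=
  forall s : Es,
    (forall e : R, 0 < e -> exists2 t, Q t & dual_norm p B (s - t) < e) -> Q s.

Definition support_function (p : {bilinear Es -> E -> R | *%R & *%R})
    (Q : set Es) : E -> \bar R :=
  fun x => ereal_sup [set (p s x)%:E | s in Q].

(* Case M = +oo: the bound holds trivially. *)
Definition support_bounded_class (p : {bilinear Es -> E -> R | *%R & *%R})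
    (B : 'Hom(E, Es)) (M : \bar R) : set (E -> \bar R) :=
  [set support_function p Q | Q in
    [set Q : set Es | [/\ Q !=set0, dual_closed p B Q, convex_set Q &
      forall s, Q s -> ((dual_norm p B s)%:E <= M)%E]]].

Definition support_diameter_class (p : {bilinear Es -> E -> R | *%R & *%R})
    (B : 'Hom(E, Es)) (M : \bar R) : set (E -> \bar R) :=
  [set support_function p Q | Q in
    [set Q : set Es | [/\ Q !=set0, dual_closed p B Q, convex_set Q &
      forall s1 s2, Q s1 -> Q s2 ->
        ((dual_norm p B (s1 - s2))%:E <= M)%E]]].

Definition subdifferential (p : {bilinear Es -> E -> R | *%R & *%R})
    (F : E -> \bar R) (x : E) : set Es :=
  [set g | forall y : E, (F x + (p g (y - x))%:E <= F y)%E].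

Definition interpolable (p : {bilinear Es -> E -> R | *%R & *%R})
    (C : set (E -> \bar R)) (I : Type) (x : I -> E) (g : I -> Es)
    (f : I -> R) : Prop :=
  exists2 F : E -> \bar R, C F &
    forall i : I, subdifferential p F (x i) (g i) /\ F (x i) = (f i)%:E.

End DualPair.

(* Main.v *)
(** Call [s] a member of the support hull of [A] when every upper bound of
    [<t, y>] over [t] in [A] also bounds [<s, y>], for all [y]. The support hull
    is closed and convex, and, being tested at [y = B^-1 s] or
    [y = B^-1 (s - t)], it satisfies the same norm and diameter bounds as [A] by
    Cauchy-Schwarz. Positive homogeneity of the support function of [Q] puts its
    subgradients in the support hull of [Q], which yields the necessary
    conditions without separating points from convex sets; conversely, the
    support function of the support hull of the [g_i] interpolates. *)

Require Import Defs.
From HB Require Import structures.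
From mathcomp Require Import all_boot all_order all_algebra.
From mathcomp Require Import all_classical all_reals all_analysis.
From mathcomp Require Import ring lra.

Import Order.TTheory GRing.Theory Num.Theory.

Local Open Scope classical_set_scope.
Local Open Scope ring_scope.

Section SupportHull.
Context {R : realType} {E Es : vectType R}.
Variable p : {bilinear Es -> E -> R | *%R & *%R}.

(** The intersection of all half-spaces [p s y <= c] containing [A]; for nondegenerate [p] it is the
    closed convex hull. *)
Definition support_hull (A : set Es) : set Es :=
  [set s | forall y c, (forall t, A t -> p t y <= c) -> p s y <= c].

Lemma sub_support_hull A : A `<=` support_hull A.
Proof. by move=> s As y c; apply. Qed.

Lemma convex_support_hull A : convex_set (support_hull A).
Proof.
move=> s t l; rewrite !inE => hs ht y c hc.
have := hs y c hc; have := ht y c hc.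
have -> : p (conv l s t) y = l%:num * p s y + (1 - l%:num) * p t y.
  by rewrite /conv /= linearDl !linearZl_LR.
have : 0 <= l%:num by exact: ge0.
have : l%:num <= 1 by exact: le1.
move: (l%:num) (p s y) (p t y) => a b d; nra.
Qed.

Lemma support_function_le (Q : set Es) y c :
  (forall s, Q s -> p s y <= c) -> (support_function p Q y <= c%:E)%E.
Proof.
by move=> h; apply: ge_ereal_sup => _ [s Qs <-]; rewrite lee_fin h.
Qed.

Lemma support_function_ge (Q : set Es) s y :
  Q s -> ((p s y)%:E <= support_function p Q y)%E.
Proof. by move=> Qs; apply: ereal_sup_ubound; exists s. Qed.

Lemma subdifferential_support_function (Q : set Es) x g f :
  support_function p Q x = f%:E ->
  subdifferential p (support_function p Q) x g ->
  p g x = f /\ support_hull Q g.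
Proof.
move=> Fx sub.
(* The support function may be infinite at [y]; a real bound [c] turns the subgradient inequality
   into one between reals. *)
have fE y c : (forall s, Q s -> p s y <= c) -> f + p g (y - x) <= c.
  move=> h; have := le_trans (sub y) (support_function_le _ _ _ h).
  by rewrite Fx -EFinD lee_fin.
have Qle s : Q s -> p s x <= f.
  by move=> Qs; rewrite -lee_fin -Fx support_function_ge.
(* Positive homogeneity of the support function, tested at [0] and [2 x]. *)
have gx : p g x = f.
  apply/eqP; rewrite eq_le; apply/andP; split.
  - have := fE (x + x) (f + f); rewrite addrK lerD2l; apply => s Qs.
    by rewrite linearD lerD ?Qle.
  - have := fE 0 0; rewrite sub0r linearN subr_le0; apply => s _.
    by rewrite linear0.
split=> // y c /fE; rewrite linearB /= gx; lra.
Qed.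

End SupportHull.

Section DualNorm.
Context {R : realType} {E Es : vectType R}.
Variables (p : {bilinear Es -> E -> R | *%R & *%R}) (B : 'Hom(E, Es)).
Hypothesis hp : nondegenerate_pairing p.
Hypothesis hBsa : self_adjoint p B.
Hypothesis hBpd : positive_definite p B.

(** Nondegeneracy makes [s] determined by its pairings with a basis of [E], so [phi] is an injective
    linear map. *)
Lemma nondegenerate_dim_le : (dim Es <= dim E)%N.
Proof.
pose b := vbasis {:E}.
pose phi s : 'rV[R]_(\dim {:E}) := \row_i p s b`_i.
have phil : linear phi.
  by move=> a s t; apply/rowP => i; rewrite !mxE linearDl linearZl_LR.
pose phiL : {linear Es -> 'rV[R]_(\dim {:E})} :=
  HB.pack phi (GRing.isLinear.Build _ _ _ _ phi phil).
have ker0 : lker (linfun phiL) == 0%VS.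
  apply/lker0P => s t; rewrite !lfunE /= => st.
  apply/eqP; rewrite -subr_eq0; apply/eqP; apply: (hp.1) => x.
  rewrite (coord_vbasis (memvf x)) linear_sum big1 // => i _ /=.
  rewrite linearZr_LR linearBl.
  by move/rowP/(_ i): st; rewrite !mxE => ->; rewrite subrr mulr0.
have := dimvS (subvf (linfun phiL @: fullv)%VS).
rewrite limg_dim_eq; last by rewrite (eqP ker0) capv0.
by rewrite !dimvf /dim /= mul1n.
Qed.

Lemma lker_pos_definite : lker B == 0%VS.
Proof.
rewrite -subv0; apply/subvP => x; rewrite memv_ker memv0 => /eqP Bx.
by apply: contraT => /hBpd; rewrite Bx linear0l ltxx.
Qed.

(** [B] is injective and [Es] is no larger than [E], so [B] is onto. *)
Lemma pos_definite_lfunVK s : B ((B^-1)%VF s) = s.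
Proof.
have ker0 := lker_pos_definite.
apply: limg_lfunVK.
suff -> : limg B = fullv by exact: memvf.
apply/eqP; rewrite eqEdim subvf /= limg_dim_eq ?(eqP ker0) ?capv0 //.
by rewrite !dimvf nondegenerate_dim_le.
Qed.

Lemma pos_definite_ge0 x : 0 <= p (B x) x.
Proof.
by have [->|/hBpd/ltW//] := eqVneq x 0; rewrite linear0.
Qed.

Lemma dual_norm_ge0 s : 0 <= dual_norm p B s.
Proof. exact: sqrtr_ge0. Qed.

Lemma sqr_dual_norm s : dual_norm p B s ^+ 2 = p s ((B^-1)%VF s).
Proof. by rewrite sqr_sqrtr // -{1}(pos_definite_lfunVK s) pos_definite_ge0. Qed.

Lemma dual_norm_CauchySchwarz s t :
  p s ((B^-1)%VF t) <= dual_norm p B s * dual_norm p B t.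
Proof.
(* Squaring the inequality requires a nonnegative left side. *)
have [ps0|ps0] := ltP (p s ((B^-1)%VF t)) 0.
  by rewrite (le_trans (ltW ps0)) // mulr_ge0 ?dual_norm_ge0.
rewrite -ler_sqr ?nnegrE ?mulr_ge0 ?dual_norm_ge0 // exprMn !sqr_dual_norm.
rewrite -[in p s](pos_definite_lfunVK s) -[in p t](pos_definite_lfunVK t).
move: ((B^-1)%VF s) ((B^-1)%VF t) => u v.
have [->|v0] := eqVneq v 0; first by rewrite !linear0 expr0n mulr0.
(* With [a], [b], [d] the values of the form at [(u, u)], [(u, v)], [(v, v)], this vector has square
   [d * (a * d - b ^+ 2)], and [d > 0] cancels. *)
have := pos_definite_ge0 (p (B v) v *: u - p (B u) v *: v).
have -> : B (p (B v) v *: u - p (B u) v *: v)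
    = p (B v) v *: B u - p (B u) v *: B v by rewrite linearB !linearZ.
rewrite linearBl !linearBr !linearZl_LR !linearZr_LR /=.
rewrite (hBsa v u); have := hBpd _ v0.
move: (p (B u) u) (p (B u) v) (p (B v) v) => a b d d0 h.
rewrite -subr_ge0 -(pmulr_rge0 _ d0).
by rewrite (le_trans h) // /GRing.scale /= le_eqVlt; apply/predU1P; left; ring.
Qed.

Lemma dual_norm_le s m : 0 <= m ->
  p s ((B^-1)%VF s) <= m * dual_norm p B s -> dual_norm p B s <= m.
Proof.
move=> m0; rewrite -sqr_dual_norm expr2.
have [->|s0] := eqVneq (dual_norm p B s) 0; first by [].
by rewrite ler_pM2r // lt_neqAle eq_sym s0 dual_norm_ge0.
Qed.

Lemma dual_closed_support_hull (A : set Es) :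
  dual_closed p B (support_hull p A).
Proof.
move=> s hs y c hc; apply/ler_addgt0Pr => e e0.
(* By Cauchy-Schwarz, pairing with [y] is Lipschitz with constant [dual_norm p B (B y)]; adding 1
   allows division by [k]. *)
pose k := dual_norm p B (B y) + 1.
have k0 : 0 < k by rewrite ltr_wpDl ?dual_norm_ge0.
have [t ht ste] := hs (e / k) (divr_gt0 e0 k0).
rewrite -[s](subrK t) addrC linearDl lerD ?ht //.
have By : (B^-1)%VF (B y) = y by exact: lker0_lfunK lker_pos_definite _.
rewrite -[y]By; apply: le_trans (dual_norm_CauchySchwarz _ _) _.
have := dual_norm_ge0 (B y); move: ste; rewrite ltr_pdivlMr // /k.
have := dual_norm_ge0 (s - t).
move: (dual_norm _ _ _) (dual_norm _ _ _) => a b; nra.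
Qed.

Lemma dual_norm_support_hull (A : set Es) (M : \bar R) : (0 <= M)%E ->
  (forall s, A s -> ((dual_norm p B s)%:E <= M)%E) ->
  forall s, support_hull p A s -> ((dual_norm p B s)%:E <= M)%E.
Proof.
case: M => [m| |] // m0 hA s hs; last by rewrite leey.
rewrite lee_fin in m0; rewrite lee_fin; apply: dual_norm_le => //; apply: hs.
move=> t /hA; rewrite lee_fin => tm.
apply: le_trans (dual_norm_CauchySchwarz _ _) _.
by rewrite ler_wpM2r ?dual_norm_ge0.
Qed.

Lemma dual_norm_sub_support_hull (A : set Es) (M : \bar R) : (0 <= M)%E ->
  (forall s t, A s -> A t -> ((dual_norm p B (s - t))%:E <= M)%E) ->
  forall s t, support_hull p A s -> support_hull p A t ->
    ((dual_norm p B (s - t))%:E <= M)%E.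
Proof.
case: M => [m| |] // m0 hA s t hs ht; last by rewrite leey.
rewrite lee_fin in m0; rewrite lee_fin; apply: dual_norm_le => //.
set N := dual_norm _ _ _; set y := (B^-1)%VF _.
(* The bound passes to the hull one argument at a time: first [s'] becomes [s], then [t'] becomes
   [t]. *)
have Ale s' t' : A s' -> A t' -> p s' y - p t' y <= m * N.
  move=> As At; rewrite -linearBl.
  apply: le_trans (dual_norm_CauchySchwarz _ _) _.
  by rewrite ler_wpM2r ?dual_norm_ge0 // -lee_fin hA.
have sle t' : A t' -> p s y <= m * N + p t' y.
  by move=> At; apply: hs => s' As; rewrite -lerBlDr Ale.
(* A lower bound on [p t y] is needed, hence the test at [- y]. *)
have := ht (- y) (m * N - p s y); rewrite linearBl linearN /=.
have H t' : A t' -> p t' (- y) <= m * N - p s y.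
  by move=> /sle; rewrite linearN /=; lra.
by move=> /(_ H); lra.
Qed.

Lemma dual_norm0 : dual_norm p B 0 = 0.
Proof. by rewrite /dual_norm linear0l sqrtr0. Qed.

End DualNorm.

Section Interpolation.
Context {R : realType} {E Es : vectType R}.
Variable p : {bilinear Es -> E -> R | *%R & *%R}.
Context {I : Type} (x : I -> E) (g : I -> Es) (f : I -> R).

Lemma support_interpolation_necessary (Q : set Es) :
  (forall i, subdifferential p (support_function p Q) (x i) (g i) /\
    support_function p Q (x i) = (f i)%:E) ->
  (forall i, support_hull p Q (g i)) /\
  forall i j, p (g i) (x i) - f i = 0 /\ p (g i - g j) (x j) <= 0.
Proof.
move=> h.
have gh i : p (g i) (x i) = f i /\ support_hull p Q (g i).
  by have [sub Fx] := h i; exact: subdifferential_support_function Fx sub.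
split=> [i|i j]; first by have [] := gh i.
have [gi hi] := gh i; have [gj _] := gh j; rewrite gi subrr; split=> //.
(* The support function equals [f j] at [x j], so [f j] bounds [Q] there, and hence also [g i] in
   its hull. *)
rewrite linearBl subr_le0 gj; apply: hi => s Qs.
by rewrite -lee_fin -(h j).2 support_function_ge.
Qed.

(** At [x i] the bound on [A] caps the support function by [f i], and [g i] attains it; then
    [f i + p (g i) (y - x i)] is just [p (g i) y]. *)
Lemma support_interpolation_sufficient (A : set Es) :
  (forall i, A (g i)) -> (forall s, A s -> forall j, p s (x j) <= f j) ->
  (forall i, p (g i) (x i) = f i) ->
  forall i, subdifferential p (support_function p (support_hull p A)) (x i) (g i)
    /\ support_function p (support_hull p A) (x i) = (f i)%:E.
Proof.
move=> Ag Af gx i; have hg := sub_support_hull p A _ (Ag i).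
have Fx : support_function p (support_hull p A) (x i) = (f i)%:E.
  apply/eqP; rewrite eq_le -{2}gx support_function_ge // andbT.
  by apply: support_function_le => s; apply => t /Af.
split=> // y; rewrite Fx -EFinD linearB /= gx addrC subrK.
exact: support_function_ge.
Qed.

(* When [I] is empty, the range of [g] is replaced by [{0}], since the sets in
   the two classes must be inhabited. *)
Lemma exists_inhabited_range : exists A : set Es,
  [/\ A !=set0, (forall i, A (g i)) &
    forall s, A s -> (I -> False) /\ s = 0 \/ exists i, s = g i].
Proof.
have [[i0]|noI] := pselect (inhabited I).
  exists (range g); split; first by exists (g i0), i0.
    by move=> i; exists i.
  by move=> _ [i _ <-]; right; exists i.
have I0 : I -> False by move=> i; apply: noI.
by exists [set 0]; split=> [|//|s ->]; [exists 0|left].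
Qed.

End Interpolation.

Theorem corollary3p7 (R : realType) (E Es : vectType R)
    (p : {bilinear Es -> E -> R | *%R & *%R}) (B : 'Hom(E, Es))
    (hp : nondegenerate_pairing p)
    (hBsa : self_adjoint p B) (hBpd : positive_definite p B)
    (M : \bar R) (hM : (0 <= M)%E)
    (I : Type) (x : I -> E) (g : I -> Es) (f : I -> R) :
  (interpolable p (support_bounded_class p B M) x g f <->
    forall i j : I,
      [/\ p (g i) (x i) - f i = 0,
          p (g i - g j) (x j) <= 0 &
          ((dual_norm p B (g i))%:E <= M)%E]) /\
  (interpolable p (support_diameter_class p B M) x g f <->
    forall i j : I,
      [/\ p (g i) (x i) - f i = 0,
          p (g i - g j) (x j) <= 0 &
          ((dual_norm p B (g i - g j))%:E <= M)%E]).
Proof.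
have [A [[s0 As0] Ag AP]] := exists_inhabited_range g.
have hull0 : support_hull p A !=set0 by exists s0; exact: sub_support_hull.
have hcl : dual_closed p B (support_hull p A) by exact: dual_closed_support_hull.
have hcv : convex_set (support_hull p A) by exact: convex_support_hull.
(* One interpolant serves both classes; only the bound on its hull differs. *)
have interp : (forall i j, p (g i) (x i) - f i = 0 /\ p (g i - g j) (x j) <= 0) ->
    forall i, subdifferential p (support_function p (support_hull p A)) (x i) (g i)
      /\ support_function p (support_hull p A) (x i) = (f i)%:E.
  move=> h; have gx i : p (g i) (x i) = f i.
    by have [/subr0_eq] := h i i.
  apply: support_interpolation_sufficient => // s As j.
  have [[I0 _]|[i ->]] := AP _ As; first by case: (I0 j).
  by rewrite -gx -subr_le0 -linearBl (h i j).2.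
split; split.
- move=> [_ [Q [_ _ _ QM] <-] /support_interpolation_necessary[hg h]] i j.
  by have [] := h i j; split=> //; exact: dual_norm_support_hull QM _ _.
- move=> h; exists (support_function p (support_hull p A)).
    exists (support_hull p A) => //; split=> //.
    apply: dual_norm_support_hull => // s /AP[[_ ->]|[i ->]].
      by rewrite dual_norm0.
    by have [] := h i i.
  by apply: interp => i j; have [] := h i j.
- move=> [_ [Q [_ _ _ QM] <-] /support_interpolation_necessary[hg h]] i j.
  have [] := h i j; split=> //.
  exact: dual_norm_sub_support_hull QM _ _ _ _.
- move=> h; exists (support_function p (support_hull p A)).
    exists (support_hull p A) => //; split=> //.
    apply: dual_norm_sub_support_hull => // s t.
    (* If [I] is empty, both points are 0 and [hM] gives the bound; the mixed cases contradict
       emptiness. *)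
    move=> /AP[[I0 ->]|[i ->]] /AP[[J0 ->]|[j ->]]; last by have [] := h i j.
    + by rewrite subrr dual_norm0.
    + by case: (I0 j).
    + by case: (J0 i).
  by apply: interp => i j; have [] := h i j.
Qed.
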